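(* Let $s_1,s_2\in\mathbb{N}$ and let $x\in\mathbb{C}$ with $|x|=1$, $x$ not a root of unity. (i) If $s_1-s_2\not\equiv 2 \pmod 4$, then $$\mathbb{E}\left[Z_n^{s_1}(x)Z_n^{s_2}(\overline{x})\right]\sim n^{\binom{s_1+s_2}{\lfloor(s_1+s_2)/2\rfloor}-1}\,C(s_1,s_2,k_0,x)\,(x^{k_0})^n\qquad(n\to\infty),$$ where $k_0:=\frac{s_1-s_2}{2}$ if $s_1-s_2=4m$, $k_0:=\frac{s_1-s_2-1}{2}$ if $s_1-s_2=4m+1$, and $k_0:=\frac{s_1-s_2+1}{2}$ if $s_1-s_2=4m+3$ ($m\in\mathbb{Z}$). (ii) If $s_1-s_2=4m+2$ with $m\in\mathbb{Z}$, set $k_0:=\frac{s_1-s_2}{2}$. Then, as $n\to\infty$, $$\mathbb{E}\left[Z_n^{s_1}(x)Z_n^{s_2}(\overline{x})\right]\sim n^{\binom{s_1+s_2}{s_2+k_0-1}-1}\Bigl(C(s_1,s_2,k_0-1,x)(x^{k_0-1})^n+C(s_1,s_2,k_0+1,x)(x^{k_0+1})^n\Bigr).$$ (iii) For every even $k_0\in\mathbb{Z}$ with $-s_1\le k_0\le s_2$, $$C(s_1,s_2,-k_0,x)=\overline{C(s_2,s_1,k_0,x)}.$$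
   Context: $\mathbb{N}=\{0,1,2,\dots\}$. $S_n$ is identified with the group of $n\times n$ permutation matrices; for $g\in S_n$, $Z_n(x)(g):=\det(I-xg)$ and $Z_n^s(x):=(Z_n(x))^s$. $\mathbb{E}$ is expectation with respect to the uniform measure on $S_n$. $A(n)\sim B(n)$ means $\lim_{n\to\infty}A(n)/B(n)=1$. For $s_1,s_2\in\mathbb{N}$ and even $k_0\in\mathbb{Z}$ with $-s_2\le k_0\le s_1$, $$C(s_1,s_2,k_0,x):=\frac{1}{\left(\binom{s_1+s_2}{s_2+k_0}-1\right)!}\prod_{\substack{k=-s_2\\k\ne k_0}}^{s_1}\left(1-x^k\overline{x}^{k_0}\right)^{(-1)^{k+1}\binom{s_1+s_2}{s_2+k}}.$$
   Formalization: In (ii), ''A ~ B'' (quotient tends to 1) fails in general, e.g. s1=3, s2=1 for generic x, as the two-term sum comes too close to 0; (ii) is instead proved as: the difference of the two sides divided by n^(binom(s1+s2, s2+k0-1)-1) tends to 0. *)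

(* Defs.v *)
From mathcomp Require Export all_boot all_order all_algebra all_fingroup.
From mathcomp Require Export complex.
From mathcomp Require Export boolp classical_sets reals topology normedtype
  sequences.

Set Implicit Arguments.
Unset Strict Implicit.
Unset Printing Implicit Defensive.

Import Order.TTheory GRing.Theory Num.Theory.
Export numFieldNormedType.Exports.

Local Open Scope classical_set_scope.
Local Open Scope ring_scope.

Section Defs.
Variable R : realType.
Local Notation C := R[i].

Definition Zn (n : nat) (x : C) (g : 'S_n) : C :=
  \det (1%:M - x *: perm_mx g).

Definition expect (n : nat) (f : 'S_n -> C) : C :=
  (\sum_(g : 'S_n) f g) / #|{perm 'I_n}|%:R.

(* E[Z_n^s1(x) Z_n^s2(xbar)] *)
Definition moment (s1 s2 : nat) (x : C) (n : nat) : C :=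
  expect (fun g : 'S_n => Zn x g ^+ s1 * Zn (x^*) g ^+ s2).

(* The binomial coefficient (s1+s2 choose s2+k); [absz] is harmless because it
   is only used for -s2 <= k <= s1. *)
Definition binz (s1 s2 : nat) (k : int) : nat :=
  'C(s1 + s2, absz (s2%:Z + k)).

(* The index k runs over -s2, ..., s1 as k = j - s2 with 0 <= j <= s1 + s2. *)
Definition Cst (s1 s2 : nat) (k0 : int) (x : C) : C :=
  ((binz s1 s2 k0 - 1)`!)%:R^-1 *
  \prod_(j < (s1 + s2).+1 | j%:Z - s2%:Z != k0)
    let k : int := j%:Z - s2%:Z in
    (1 - x ^ k * (x^*) ^ k0) ^ ((-1) ^ (k + 1) * (binz s1 s2 k)%:Z).

Definition asymp_equiv (A B : nat -> C) : Prop :=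
  (fun n => A n / B n : C^o) @ \oo --> (1 : C^o).

(* A(n) = B(n) + o(w(n)).  If B(n) / w(n) has constant nonzero modulus this is
   the same as [asymp_equiv A B].  It is the reading of A ~ B when B is w(n)
   times a sum of two oscillating terms of equal modulus.  Such a sum comes
   arbitrarily close to 0, and the quotient A / B need not converge: for the
   moment with s1 = 3, s2 = 1 and x = exp(i theta) it does not, unless
   tan(theta / 2) ^ 4 = 5. *)
Definition asymp_equiv_rel (w A B : nat -> C) : Prop :=
  (fun n => (A n - B n) / w n : C^o) @ \oo --> (0 : C^o).

(* k0 in terms of d = s1 - s2, for d not congruent to 2 modulo 4; %/ and %%
   are Euclidean, so (d %% 4)%Z is in {0, 1, 2, 3} for negative d as well. *)
Definition k0_of (d : int) : int :=
  if (d %% 4)%Z == 0 then (d %/ 2)%Z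
  else if (d %% 4)%Z == 1 then ((d - 1) %/ 2)%Z
  else ((d + 1) %/ 2)%Z.

End Defs.

(* Main.v *)
(**
Contracting an arc of a permutation turns det (I - diag(d) g) into a
determinant of the same kind for a permutation of one point less.  Averaging
over the symmetric group, the moments M_n satisfy
  (n + 1) M_(n+1) = sum_(k <= n) F(x^(k+1)) M_(n-k),
  F(y) = (1 - y)^s1 (1 - 1/y)^s2 = sum_k (-1)^k binom(s1 + s2, s2 + k) y^k,
i.e. their generating function has the logarithmic derivative of
  prod_k (1 - x^k t)^(- (-1)^k binom(s1 + s2, s2 + k)).
As the x^k are distinct and of modulus 1, the poles of maximal order, which are
among those with even k, give the main term.  The transfer of singularities is
done by induction on the total order of the zeros and poles: a factor
1 - c t multiplies the contribution of the pole q_k by 1 - c / q_k, and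
  (q_j - q_i) = q_j (1 - q_i t) - q_i (1 - q_j t)
lowers the number of poles until only one is left.
*)

Require Import Defs.
From mathcomp Require Import ring zify.

Set Implicit Arguments.
Unset Strict Implicit.
Unset Printing Implicit Defensive.

Import Order.TTheory GRing.Theory Num.Theory.
Local Open Scope ring_scope.

(** * Averages of weighted characteristic polynomials *)

Lemma lift_eqF n (j : 'I_n) (i : 'I_n.-1) : (lift j i == j) = false.
Proof. by rewrite lift_eqF. Qed.

Section WeightedCharPoly.
Variable K : comNzRingType.

Definition wdet (n : nat) (d : 'I_n -> K) (g : 'S_n) : K :=
  \det (\matrix_(a, b) ((a == b)%:R - d a * (g a == b)%:R)).

Lemma wdet_fix n (d : 'I_n.+1 -> K) (j : 'I_n.+1) (h : 'S_n) :
  wdet d (lift_perm j j h) = (1 - d j) * wdet (d \o lift j) h.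
Proof.
rewrite /wdet (expand_det_col _ j) (bigD1 j) //= big1 ?addr0; last first.
  move=> a aj; rewrite mxE (negbTE aj) sub0r.
  case: (unliftP j a) aj => [a' -> _|->]; last by rewrite eqxx.
  by rewrite lift_perm_lift lift_eqF mulr0 oppr0 mul0r.
rewrite !mxE lift_perm_id eqxx !mulr1 /cofactor -signr_odd oddD addbb mul1r.
congr (_ * \det _); apply/matrixP => a b.
by rewrite !mxE lift_perm_lift !(inj_eq (@lift_inj _ _)).
Qed.

(* Contracting the arc i -> j multiplies the weights of its end points. *)
Lemma wdet_contract n (d : 'I_n.+1 -> K) (j : 'I_n.+1) (i : 'I_n) (h : 'S_n) :
  wdet d (tperm (lift j i) j * lift_perm j j h)%g =
  wdet (fun a => if a == i then d (lift j i) * d j else d (lift j a)) h.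
Proof.
set g := (_ * _)%g.
have gi : g (lift j i) = j by rewrite permM tpermL lift_perm_id.
have gj : g j = lift j (h i) by rewrite permM tpermR lift_perm_lift.
have gl a : a != i -> g (lift j a) = lift j (h a).
  move=> ai; rewrite permM tpermD ?lift_perm_lift ?neq_lift //.
  by rewrite (inj_eq (@lift_inj _ _)) eq_sym.
rewrite /wdet; set M := \matrix_(a, b) _.
(* Adding [d (lift j i)] times row [j] to row [lift j i] clears the only off-diagonal entry of
   column [j]; the diagonal entry is 1 because [g j != j]. The determinant does not change, as [B]
   has two equal rows. *)
pose A := \matrix_(a, b) (M a b + (a == lift j i)%:R * d (lift j i) * M j b).
pose B := \matrix_(a, b) (if a == lift j i then M j b else M a b).
have detA : \det A = 1 * \det M + d (lift j i) * \det B.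
  apply: (@determinant_multilinear _ _ _ _ _ (lift j i)).
  - by apply/matrixP => a b; rewrite !mxE eqxx !mul1r.
  - apply/matrixP => a b; rewrite !mxE lift_eqF.
    by rewrite !mul0r addr0.
  - apply/matrixP => a b; rewrite !mxE lift_eqF.
    by rewrite !mul0r addr0.
have detB : \det B = 0.
  apply: (@determinant_alternate _ _ _ j (lift j i)); first exact: neq_lift.
  by move=> b; rewrite !mxE eqxx if_same.
move: detA; rewrite detB mulr0 addr0 mul1r => <-.
rewrite (expand_det_col _ j) (bigD1 j) //= big1 ?addr0; last first.
  move=> a; case: (unliftP j a) => [a' ->|->]; last by rewrite eqxx.
  move=> _; rewrite !mxE (inj_eq (@lift_inj _ _)) eqxx gj.
  rewrite !lift_eqF.
  have [->|/gl->] := eqVneq a' i.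
    by rewrite gi eqxx /=; ring.
  by rewrite lift_eqF /=; ring.
rewrite !mxE gj eqxx (negbTE (neq_lift _ _)).
rewrite !lift_eqF.
rewrite /cofactor -signr_odd oddD addbb expr0 mul1r mulr0 subr0 !mul0r addr0.
rewrite mul1r; congr (\det _); apply/matrixP => a b.
rewrite !mxE !(inj_eq (@lift_inj _ _)) (negbTE (neq_lift _ _)) gj.
have [->|/gl->] := eqVneq a i.
  by rewrite gi (negbTE (neq_lift _ _)) (inj_eq (@lift_inj _ _)) /=; ring.
by rewrite (inj_eq (@lift_inj _ _)) /=; ring.
Qed.

(** Classifies permutations by the predecessor of [j]: either [j] itself, or some [lift j i], in
    which case contracting the arc into [j] leaves [h]. *)
Lemma sum_perm_pred (V : nmodType) n (j : 'I_n.+1) (F : 'S_n.+1 -> V) :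
  \sum_g F g = \sum_(h : 'S_n) F (lift_perm j j h) +
    \sum_(i < n) \sum_(h : 'S_n) F (tperm (lift j i) j * lift_perm j j h)%g.
Proof.
pose f (p : 'I_n.+1 * 'S_n) := (tperm p.1 j * lift_perm j j p.2)%g.
have f_inj : injective f.
  case=> [i h] [i' h'] eq_f; have fj i0 h0 : f (i0, h0) i0 = j.
    by rewrite permM tpermL lift_perm_id.
  have ii' : i = i'.
    by apply: (@perm_inj _ (f (i, h))); rewrite [in RHS]eq_f !fj.
  move: eq_f; rewrite /f ii' => /mulgI eq_lift; congr (_, _).
  apply/permP => k; apply: (@lift_inj _ j).
  by rewrite -!(lift_perm_lift j) eq_lift.
(* Injectivity suffices, since [(n + 1) * n! = (n + 1)!]. *)
have f_bij : bijective f.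
  apply: inj_card_bij f_inj _.
  by rewrite card_prod card_ord !card_Sn factS.
rewrite (reindex f) /=; last exact: onW_bij.
rewrite -(pair_big xpredT xpredT (fun i h => F (f (i, h)))) /=.
rewrite (bigD1_ord j) //=; congr (_ + _).
by apply: eq_bigr => h _; rewrite /f tperm1 mul1g.
Qed.

End WeightedCharPoly.

(** * Recursion for the moments by following the cycle of a marked point *)

Section MomentRecursion.
Variables (K : comNzRingType) (s1 s2 : nat) (x x' : K).

Definition marked_weight (n : nat) (j : 'I_n) (y z : K) : 'I_n -> K :=
  fun a => if a == j then y else z.

Definition wsum (n : nat) : K :=
  \sum_(g : 'S_n) wdet (fun=> x) g ^+ s1 * wdet (fun=> x') g ^+ s2.

Definition marked_wsum (n : nat) (j : 'I_n) (y y' : K) : K :=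
  \sum_(g : 'S_n)
    wdet (marked_weight j y x) g ^+ s1 * wdet (marked_weight j y' x') g ^+ s2.

Lemma eq_wdet n (d e : 'I_n -> K) g : d =1 e -> wdet d g = wdet e g.
Proof.
by move=> de; congr (\det _); apply/matrixP => a b; rewrite !mxE de.
Qed.

Lemma marked_weight_lift n (j : 'I_n.+1) y z :
  marked_weight j y z \o lift j =1 fun=> z.
Proof. by move=> a; rewrite /marked_weight /= lift_eqF. Qed.

Lemma marked_wsumS n (j : 'I_n.+1) y y' :
  marked_wsum j y y' = (1 - y) ^+ s1 * (1 - y') ^+ s2 * wsum n
    + \sum_(i < n) marked_wsum i (x * y) (x' * y').
Proof.
rewrite /marked_wsum (sum_perm_pred j); congr (_ + _).
  rewrite /wsum mulr_sumr; apply: eq_bigr => h _.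
  rewrite !wdet_fix !(eq_wdet _ (marked_weight_lift _ _ _)) /marked_weight
    eqxx !exprMn.
  by rewrite mulrACA.
have E z u i (h : 'S_n) :
  wdet (marked_weight j z u) (tperm (lift j i) j * lift_perm j j h) =
    wdet (marked_weight i (u * z) u) h.
  rewrite wdet_contract; apply: eq_wdet => a.
  by rewrite /marked_weight eqxx !lift_eqF.
by apply: eq_bigr => i _; apply: eq_bigr => h _; rewrite !E.
Qed.

(** The index [k] counts the contractions made before the marked point becomes fixed, so its cycle
    has length [k + 1]; [n ^_ k] counts the chains of [k] successive predecessors. *)
Lemma marked_wsumE n (j : 'I_n.+1) y y' :
  marked_wsum j y y' = \sum_(k < n.+1) (n ^_ k)%:R *
    ((1 - x ^+ k * y) ^+ s1 * (1 - x' ^+ k * y') ^+ s2) * wsum (n - k).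
Proof.
elim: n j y y' => [|n IHn] j y y'; rewrite marked_wsumS.
  by rewrite big_ord0 big_ord1 addr0 subn0 !expr0 !mul1r.
rewrite [RHS]big_ord_recl /= subn0 ffactn0 !expr0 !mul1r; congr (_ + _).
rewrite (eq_bigr _ (fun i _ => IHn i _ _)) sumr_const card_ord -sumrMnl.
apply: eq_bigr => k _;
  rewrite /bump /= add1n ffactnS subSS natrM /= !exprSr !mulrA.
by rewrite -[LHS]mulr_natl !mulrA.
Qed.

Lemma wsumS n : wsum n.+1 = \sum_(k < n.+1) (n ^_ k)%:R *
    ((1 - x ^+ k.+1) ^+ s1 * (1 - x' ^+ k.+1) ^+ s2) * wsum (n - k).
Proof.
have -> : wsum n.+1 = marked_wsum (ord0 : 'I_n.+1) x x'.
  by apply: eq_bigr => g _; congr (_ ^+ _ * _ ^+ _); apply: eq_wdet => a;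
     rewrite /marked_weight if_same.
by rewrite marked_wsumE; apply: eq_bigr => k _; rewrite !exprSr.
Qed.

End MomentRecursion.

(** * Sequences with a given logarithmic derivative *)

Section LogDerivative.
Variable K : numFieldType.
Implicit Types (p S T : nat -> K) (q : K).

(** Coefficient form of [S(0) = 1] and [t S'(t) = p(t) S(t)], where [p(t)] is the sum of the
    [p m * t ^ m] over [m >= 1]. *)
Definition logder p S : Prop :=
  S 0 = 1 /\
  forall n, n.+1%:R * S n.+1 = \sum_(k < n.+1) p k.+1 * S (n - k)%N.

(** On generating functions this is multiplication by [t], and [mul1BqX q] is multiplication by
    [1 - q t]. *)
Definition delay S n : K := if n is m.+1 then S m else 0.

Definition mul1BqX q S n : K := S n - q * delay S n.

Lemma eq_logder p p' S : p =1 p' -> logder p S -> logder p' S.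
Proof.
move=> pp' [S0 HS]; split=> // n.
by rewrite HS; apply: eq_bigr => k _; rewrite pp'.
Qed.

Lemma logder_uniq p S T : logder p S -> logder p T -> S =1 T.
Proof.
move=> [S0 HS] [T0 HT]; elim/ltn_ind => -[|n] IH; first by rewrite S0 T0.
apply: (mulfI (_ : n.+1%:R != 0)); first by rewrite pnatr_eq0.
by rewrite HS HT; apply: eq_bigr => k _; rewrite IH // ltnS leq_subr.
Qed.

Lemma logder_exists p : exists S, logder p S.
Proof.
(* [L n] lists the values at [n], ..., 0, latest first, so its entry [k] is the value at [n - k]. *)
pose fix L n : seq K := if n is m.+1 then
  (m.+1%:R^-1 * \sum_(k < m.+1) p k.+1 * (L m)`_k) :: L m else [:: 1].
have nthL n k : (k <= n)%N -> (L n)`_k = head 0 (L (n - k)%N).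
  elim: n k => [|n IHn] [|k] //=; rewrite ltnS => kn.
  by rewrite IHn.
exists (fun n => head 0 (L n)); split=> // n.
rewrite /= mulrA divff ?pnatr_eq0 // mul1r; apply: eq_bigr => k _.
by rewrite nthL // leq_ord.
Qed.

(** The factor [1 - q t] contributes [- q t / (1 - q t)], whose coefficients are [- q ^ m]. *)
Lemma logder_mul1BqX p q S :
  logder p S -> logder (fun m => p m - q ^+ m) (mul1BqX q S).
Proof.
move=> [S0 HS]; split=> [|n]; first by rewrite /mul1BqX /= mulr0 subr0.
(* Coefficientwise, [q t / (1 - q t)] times [(1 - q t) S] is [q t S]. *)
have telescope m : \sum_(k < m.+1) q ^+ k.+1 * mul1BqX q S (m - k) = q * S m.
  elim: m => [|m IHm].
    by rewrite big_ord1 /= /mul1BqX /= mulr0 subr0 expr1.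
  rewrite big_ord_recl /= subn0 expr1 {1}/mul1BqX /=.
  rewrite (eq_bigr (fun k : 'I_m.+1 => q * (q ^+ k.+1 * mul1BqX q S (m - k)))).
    by rewrite -mulr_sumr IHm; ring.
  by move=> k _; rewrite /bump /= add1n subSS exprS mulrA.
under eq_bigr do rewrite mulrBl.
rewrite sumrB telescope /mul1BqX /= mulrBr HS.
under [in RHS]eq_bigr do rewrite mulrBr.
rewrite sumrB -!addrA; congr (_ + _).
(* This is the recursion for [S] one index earlier; both sides vanish for [n = 0]. *)
have -> : \sum_(k < n.+1) p k.+1 * (q * delay S (n - k)) = n%:R * (q * S n).
  case: n => [|n]; first by rewrite big_ord1 /= !mulr0 mul0r.
  rewrite big_ord_recr /= subnn !mulr0 addr0 mulrCA HS mulr_sumr.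
  by apply: eq_bigr => k _; rewrite subSn ?leq_ord //= mulrCA.
by rewrite -natr1; ring.
Qed.

(** * Products of integer powers of linear factors *)

Section PowerSums.
Variables (I : finType) (q : I -> K).
Implicit Types (a : I -> int) (i j : I).

(** Logarithmic derivative of the product of the [(1 - q i * t) ^ (- a i)]: a positive [a i] stands
    for a pole, a negative one for a zero. *)
Definition psum a m : K := \sum_i (a i)%:~R * q i ^+ m.

Definition decr a i : I -> int := fun k => a k - (k == i)%:Z.

Lemma logder_decr a i S :
  logder (psum a) S -> logder (psum (decr a i)) (mul1BqX (q i) S).
Proof.
move=> /(logder_mul1BqX (q i)); apply: eq_logder => m.
rewrite /psum (bigD1 i) //= [in RHS](bigD1 i) //= /decr eqxx.
rewrite rmorphB /= mulrBl mul1r addrAC; congr (_ + _).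
by apply: eq_bigr => k /negbTE ->; rewrite subr0.
Qed.

(** Here [S] is [(1 - q i * t) ^ (- b.+1)]. Induction on [b] strips one factor; Pascal's rule
    restores it. *)
Lemma logder_single i b S :
  logder (psum (fun k => (k == i)%:Z * b.+1%:Z)) S ->
  forall n, S n = q i ^+ n * 'C(n + b, b)%:R.
Proof.
elim: b S => [|b IHb] S HS.
  have {}HS := logder_decr i HS.
  have T0 n : mul1BqX (q i) S n.+1 = 0.
    apply: (mulfI (_ : n.+1%:R != 0)); first by rewrite pnatr_eq0.
    rewrite HS.2 mulr0 big1 // => k _; rewrite /psum big1 ?mul0r // => l _.
    by rewrite /decr mulr1 subrr mul0r.
  elim=> [|n IHn].
    by rewrite bin0 mul1r; have [] := HS; rewrite /mul1BqX /= mulr0 subr0.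
  move: (T0 n); rewrite /mul1BqX /= IHn !bin0 !mulr1 => /eqP.
  by rewrite subr_eq0 exprS => /eqP.
have T n : mul1BqX (q i) S n = q i ^+ n * 'C(n + b, b)%:R.
  apply: IHb; apply: eq_logder (logder_decr i HS) => m.
  apply: eq_bigr => k _; congr (_%:~R * _); rewrite /decr.
  by case: (k == i); lia.
elim=> [|n IHn].
  by move: (T 0%N); rewrite /mul1BqX /= mulr0 subr0 !add0n !binn.
move: (T n.+1); rewrite /mul1BqX /= IHn => /eqP; rewrite subr_eq => /eqP ->.
by rewrite exprS (addSn n b.+1) binS natrD addnS addSn; ring.
Qed.

Lemma mul1BqX_partial i j S n :
  (q j - q i) * S n = q j * mul1BqX (q i) S n - q i * mul1BqX (q j) S n.
Proof. by rewrite /mul1BqX; ring. Qed.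

End PowerSums.
End LogDerivative.

(** * Contribution of the poles of maximal order *)

Section NullSequences.
Variable K : numFieldType.
Implicit Types u v : nat -> K.

(** An explicit form over any [numFieldType], where [0 < e] makes [e] real; [null_cvg] turns it into
    filter convergence at the end. *)
Definition null u : Prop :=
  forall e : K, 0 < e -> exists N, forall n, (N <= n)%N -> `|u n| < e.

Lemma eq_null u v : u =1 v -> null u -> null v.
Proof. by move=> uv nu e /nu[N HN]; exists N => n /HN; rewrite uv. Qed.

Lemma nullD u v : null u -> null v -> null (fun n => u n + v n).
Proof.
move=> nu nv e e0; have e20 : 0 < e / 2 by rewrite divr_gt0.
have [M HM] := nu _ e20; have [N HN] := nv _ e20.
exists (maxn M N) => n; rewrite geq_max => /andP[/HM Hu /HN Hv].
by rewrite (splitr e) (le_lt_trans (ler_normD _ _)) ?ltrD.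
Qed.

Lemma nullM_bounded u v (B : K) :
  null u -> (forall n, `|v n| <= B) -> null (fun n => v n * u n).
Proof.
move=> nu vB e e0.
have B0 : 0 < B + 1 by rewrite ltr_wpDl // (le_trans _ (vB 0%N)).
have [N HN] := nu _ (divr_gt0 e0 B0); exists N => n /HN Hu.
rewrite normrM -(divfK (lt0r_neq0 B0) e) mulrC.
apply: (@le_lt_trans _ _ (`|u n| * (B + 1))); last by rewrite ltr_pM2r.
by rewrite ler_wpM2l // (le_trans (vB n)) // lerDl.
Qed.

Lemma nullZ (c : K) u : null u -> null (fun n => c * u n).
Proof. by move=> nu; apply: (nullM_bounded (v := fun=> c) nu) => n. Qed.

Lemma null0 : null (fun=> 0).
Proof. by move=> e e0; exists 0%N => n _; rewrite normr0. Qed.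

Lemma nullB u v : null u -> null v -> null (fun n => u n - v n).
Proof.
move=> nu nv; have := nullD nu (nullZ (-1) nv).
by apply: eq_null => n; rewrite mulN1r.
Qed.

(** Lets index 0 be ignored, where [delay] has its default value and a quotient by a power of [n%:R]
    may degenerate. *)
Lemma null_delayed u : null (fun n => u n.+1) -> null u.
Proof.
by move=> nu e /nu[N HN]; exists N.+1 => -[//|n]; rewrite ltnS; apply: HN.
Qed.

Lemma null_shift u : null u -> null (fun n => u n.+1).
Proof. by move=> nu e /nu[N HN]; exists N => n /leqW; apply: HN. Qed.

Lemma null_bounded u : null u -> exists B, forall n, `|u n| <= B.
Proof.
move=> /(_ 1 ltr01)[N HN]; exists (1 + \sum_(k < N) `|u k|) => n.
have [Nn|nN] := leqP N n.
  by rewrite (le_trans (ltW (HN _ Nn))) // lerDl sumr_ge0.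
rewrite (bigD1 (Ordinal nN)) //= addrCA lerDl addr_ge0 ?ler01 // sumr_ge0 //.
Qed.

Lemma nullM u v : null u -> null v -> null (fun n => u n * v n).
Proof. by move=> /null_bounded[B uB] nv; apply: nullM_bounded uB. Qed.

Lemma null_prod1 u v : null (fun n => u n - 1) -> null (fun n => v n - 1) ->
  null (fun n => u n * v n - 1).
Proof.
move=> nu nv; have := nullD (nullM nu nv) (nullD nu nv).
by apply: eq_null => n; ring.
Qed.

End NullSequences.

(** * Growth scales of poles and transfer of singularities *)

Section PoleAsymptotics.
Variable K : numFieldType.
Hypothesis archiK : forall e : K, 0 < e -> exists N : nat, e < N%:R.

Lemma null_inv (c : nat) : null (fun n => (n + c)%:R^-1 : K).
Proof.
move=> e e0; have [N HN] := archiK (divr_gt0 ltr01 e0).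
exists N => n Nn; have {HN} : 1 / e < (n + c)%:R.
  by apply: lt_le_trans HN _; rewrite ler_nat (leq_trans Nn) ?leq_addr.
rewrite ltr_pdivrMr // mulrC => H.
have nc0 : 0 < (n + c)%:R :> K.
  by move: (lt_trans ltr01 H); rewrite pmulr_rgt0.
by rewrite ger0_norm ?invr_ge0 ?ler0n // -[_^-1]mul1r ltr_pdivrMr.
Qed.

(** The coefficient of [t ^ n] in [(1 - t) ^ (- e.+1)], hence the exact scale of a pole of order
    [e.+1]. *)
Definition pole_growth (e n : nat) : K := 'C(n + e, e)%:R.

Lemma pole_growth_gt0 e n : 0 < pole_growth e n.
Proof. by rewrite ltr0n bin_gt0 leq_addl. Qed.

Lemma pole_growth_neq0 e n : pole_growth e n != 0.
Proof. exact: lt0r_neq0 (pole_growth_gt0 e n). Qed.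

Lemma pole_growthS e n : pole_growth e.+1 n =
  pole_growth e n * ((n + e.+1)%:R / e.+1%:R).
Proof.
apply: (mulfI (_ : e.+1%:R != 0)); first by rewrite pnatr_eq0.
rewrite [RHS]mulrCA (mulrC e.+1%:R (_ / _)) divfK ?pnatr_eq0 // -!natrM.
congr _%:R.
by rewrite -mul_bin_diag addnS mulnC.
Qed.

(** The quotient is [(n + 1) / (n + e + 1)], so a delay by one index costs a relative error of order
    [1 / n]. *)
Lemma pole_growth_step e n : pole_growth e n / pole_growth e n.+1 - 1 =
  - e%:R * (n + e.+1)%:R^-1.
Proof.
have E : (n + e.+1)%:R * pole_growth e n = n.+1%:R * pole_growth e n.+1.
  rewrite -!natrM; congr (_%:R); rewrite addnS addSn.
  by rewrite (mul_bin_down (n + e).+1 e) -addSn addnK.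
have h : (n + e.+1)%:R != 0 :> K by rewrite addnS pnatr_eq0.
have -> : pole_growth e n / pole_growth e n.+1 = n.+1%:R / (n + e.+1)%:R.
  by apply/eqP; rewrite eqr_div ?pole_growth_neq0 // mulrC E.
have -> : n.+1%:R = (n + e.+1)%:R - e%:R :> K.
  by rewrite -addSnnS natrD addrK.
by rewrite mulrBl divff // addrAC subrr add0r mulNr.
Qed.

Lemma pole_growth_ratio_le1 b e n : (b <= e)%N ->
  pole_growth b n / pole_growth e n <= 1.
Proof.
move=> be; rewrite ler_pdivrMr ?pole_growth_gt0 // mul1r.
elim: e be => [|e IHe]; first by rewrite leqn0 => /eqP->.
rewrite leq_eqVlt ltnS => /predU1P[->//|/IHe/le_trans]; apply.
rewrite pole_growthS ler_peMr ?(ltW (pole_growth_gt0 _ _)) //.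
by rewrite ler_pdivlMr ?ltr0n // mul1r ler_nat leq_addl.
Qed.

(** Poles of lower order are negligible: the last step of the scale gives a factor of order [1 / n],
    and the remaining quotient is at most 1. *)
Lemma null_pole_growth_ratio b e : (b < e)%N ->
  null (fun n => pole_growth b n / pole_growth e n).
Proof.
case: e => // e; rewrite ltnS => be.
have bd n : `|pole_growth b n / pole_growth e n| <= 1.
  by rewrite ger0_norm ?pole_growth_ratio_le1 // divr_ge0
    ?(ltW (pole_growth_gt0 _ _)).
have := nullM_bounded (nullZ e.+1%:R (@null_inv e.+1)) bd.
apply: eq_null => n; rewrite pole_growthS invfM [in RHS]mulrA; congr (_ * _).
by rewrite invfM invrK mulrC.
Qed.

Lemma null_pole_growth_pow e :
  null (fun n => pole_growth e n * e`!%:R / n%:R ^+ e - 1).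
Proof.
elim: e => [|e IHe].
  by apply: eq_null (@null0 _) => n;
    rewrite /pole_growth bin0 fact0 expr0 !mulr1 divr1 subrr.
apply: null_delayed.
have N1 : null (fun n => (n.+1 + e.+1)%:R / n.+1%:R - 1 : K).
  have := nullZ e.+1%:R (@null_inv 1); apply: eq_null => n.
  by rewrite (natrD _ n.+1) mulrDl divff ?pnatr_eq0 // addrAC subrr add0r addn1.
have := null_prod1 (null_shift IHe) N1; apply: eq_null => n.
rewrite pole_growthS factS natrM exprSr; congr (_ - 1).
by field; rewrite expf_neq0 ?pnatr_eq0 // !nat1r !pnatr_eq0.
Qed.

Section Poles.
Variables (I : finType) (q : I -> K).
Hypothesis q_norm : forall i, `|q i| = 1.
Hypothesis q_inj : injective q.
Implicit Types (a : I -> int) (i j k : I) (L : I -> K).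

Lemma q_neq0 i : q i != 0.
Proof. by rewrite -normr_eq0 q_norm oner_eq0. Qed.

Definition pole_asymp e (S : nat -> K) L : Prop :=
  null (fun n => S n / pole_growth e n - \sum_k L k * q k ^+ n).

Lemma osc_bounded L n : `|\sum_k L k * q k ^+ n| <= \sum_k `|L k|.
Proof.
apply: le_trans (ler_norm_sum _ _ _) _; apply: ler_sum => k _.
by rewrite normrM normrX q_norm expr1n mulr1.
Qed.

Lemma pole_asymp_mul1BqX e S L c :
  pole_asymp e S L ->
  pole_asymp e (mul1BqX c S) (fun k => L k * (1 - c / q k)).
Proof.
move=> H; apply: null_delayed.
set D := fun n => S n / pole_growth e n - \sum_k L k * q k ^+ n in H.
pose r n := pole_growth e n / pole_growth e n.+1 - 1.
have nr : null r.
  have := nullZ (- e%:R) (@null_inv e.+1); apply: eq_null => n.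
  by rewrite /r pole_growth_step.
(* Since [S n / pole_growth e n.+1] is [(1 + r n)] times the sum of [D n] and the oscillating sum,
   the new error at [n.+1] is [D n.+1 - c (D n + r n * D n)] minus [c * r n] times that sum. *)
have H1 := nullB (null_shift H) (nullZ c (nullD H (nullM nr H))).
have H2 := nullZ c (nullM_bounded nr (osc_bounded L)).
have := nullB H1 H2; apply: eq_null => n.
rewrite /mul1BqX /D /r /=.
have -> : \sum_k L k * (1 - c / q k) * q k ^+ n.+1 =
    \sum_k L k * q k ^+ n.+1 - c * \sum_k L k * q k ^+ n.
  rewrite mulr_sumr -sumrB; apply: eq_bigr => k _.
  by rewrite exprS; field; apply: q_neq0.
by move: (pole_growth_neq0 e n) (pole_growth_neq0 e n.+1) => *; field;
  apply/andP.
Qed.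

(** The value at [t = 1 / q k] of the product without its factor for [k], kept only for poles of
    order [e.+1]. *)
Definition lead e a k : K :=
  if a k == e.+1%:Z then \prod_(l | l != k) (1 - q l / q k) ^ (- a l) else 0.

Lemma eq_lead e a b k : a =1 b -> lead e a k = lead e b k.
Proof.
by move=> ab; rewrite /lead ab; case: eqP => // _; apply: eq_bigr => l _;
  rewrite ab.
Qed.

(** For [k = i] both sides vanish: the factor is 0, and since no order exceeds [e.+1], the lowered
    order is below it. *)
Lemma lead_decr e a i k : (forall l, a l <= e.+1%:Z) ->
  lead e (decr a i) k = lead e a k * (1 - q i / q k).
Proof.
move=> ae; rewrite /lead {1}/decr; have [->|ki] := eqVneq k i.
  rewrite divff ?q_neq0 // subrr mulr0 ifF //.
  by apply/negbTE; have := ae i; lia.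
rewrite subr0; case: eqP => _; last by rewrite mul0r.
rewrite (bigD1 i) 1?eq_sym //= [in RHS](bigD1 i) 1?eq_sym //= /decr eqxx.
have h : 1 - q i / q k != 0.
  rewrite subr_eq0 eq_sym; apply: contraNneq ki => h.
  by apply/eqP/q_inj; rewrite -(divfK (q_neq0 k) (q i)) h mul1r.
rewrite opprB expfzDr // -mulrA mulrC; congr (_ * _ * _).
by apply: eq_bigr => l /andP[_ /negbTE->]; rewrite subr0.
Qed.

Lemma pole_asymp_main e a S : (forall i, a i <= e.+1%:Z) ->
  logder (psum q a) S -> pole_asymp e S (lead e a).
Proof.
move: {2}(\sum_i absz (a i))%N (leqnn (\sum_i absz (a i))%N) => m.
elim/ltn_ind: m a S => m IH a S am ae HS.
have dec_le b i c : (absz (c i) < absz (b i))%N ->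
    (forall k, k != i -> c k = b k) ->
    (\sum_i absz (c i) < \sum_i absz (b i))%N.
  move=> bi bk; rewrite (bigD1 i) // [X in (_ < X)%N](bigD1 i) //=.
  by rewrite (eq_bigr (fun k => absz (b k))) ?ltn_add2r // => k /bk->.
(* A zero: [S] is [1 - q j * t] times the series [S'] with one zero less, of smaller total order. *)
case: (pickP (fun j => a j < 0)) => [j aj|a_ge0].
  pose a' k := a k + (k == j)%:Z.
  have a'E : decr a' j =1 a by move=> k; rewrite /decr /a' addrK.
  have a'e i : a' i <= e.+1%:Z.
    by rewrite /a'; have [->|] := eqVneq i j; have := ae i; lia.
  have [S' HS'] := logder_exists (psum q a').
  have ES : S =1 mul1BqX (q j) S'.
    apply: logder_uniq HS (eq_logder _ (logder_decr j HS')) => t.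
    by apply: eq_bigr => k _; rewrite a'E.
  have lt : (\sum_i absz (a' i) < m)%N.
    apply: leq_trans am; apply: (dec_le _ j); first by rewrite /a' eqxx; lia.
    by move=> k /negbTE kj; rewrite /a' kj addr0.
  have := pole_asymp_mul1BqX (q j) (IH _ lt _ _ (leqnn _) a'e HS').
  apply: eq_null => n; rewrite ES; congr (_ - _); apply: eq_bigr => k _.
  by rewrite -lead_decr // (eq_lead _ _ a'E).
have decr_IH i : 0 < a i ->
    pole_asymp e (mul1BqX (q i) S) (fun k => lead e a k * (1 - q i / q k)).
  move=> ai; have := IH (\sum_k absz (decr a i k))%N.
  move=> /(_ _ _ _ (leqnn _) _ (logder_decr i HS)) H.
  apply: eq_null (H _ _) => [n| |k].
  - by congr (_ - _); apply: eq_bigr => k _; rewrite lead_decr.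
  - apply: leq_trans am; apply: (dec_le _ i); first by rewrite /decr eqxx; lia.
    by move=> k /negbTE ki; rewrite /decr ki subr0.
  - by rewrite /decr; have := ae k; lia.
case: (pickP (fun i => 0 < a i)) => [i ai|a_le0]; last first.
  (* No zeros or poles remain, so the series is the constant 1. *)
  have a0 i : a i = 0 by have := a_ge0 i; have := a_le0 i; lia.
  apply: null_delayed; apply: eq_null (@null0 _) => n.
  have -> : S n.+1 = 0.
    apply: (mulfI (_ : n.+1%:R != 0)); first by rewrite pnatr_eq0.
    rewrite HS.2 mulr0 big1 // => k _; rewrite /psum big1 ?mul0r // => l _.
    by rewrite a0 mul0r.
  by rewrite mul0r big1 ?subr0 // => k _; rewrite /lead a0 mul0r.
(* Two distinct poles: partial fractions express [S] through two series covered by [decr_IH], and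
   the coefficients recombine by the same identity divided by [q k]. *)
case: (pickP (fun j => (j != i) && (0 < a j))) => [j /andP[ji aj]|a_single].
  have qij : q j - q i != 0.
    by rewrite subr_eq0; apply: contraNneq ji => /q_inj ->.
  have := nullZ (q j - q i)^-1
    (nullB (nullZ (q j) (decr_IH i ai)) (nullZ (q i) (decr_IH j aj))).
  apply: eq_null => n; apply: (mulfI qij); rewrite mulVKf //.
  rewrite [RHS]mulrBr mulrA mul1BqX_partial.
  rewrite [in RHS]mulr_sumr !mulrBr !mulr_sumr.
  have -> : \sum_k (q j - q i) * (lead e a k * q k ^+ n) =
    \sum_k q j * (lead e a k * (1 - q i / q k) * q k ^+ n) -
    \sum_k q i * (lead e a k * (1 - q j / q k) * q k ^+ n).
    rewrite -sumrB; apply: eq_bigr => k _; field; exact: q_neq0.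
  by rewrite !mulrBl; ring.
have a0 k : k != i -> a k = 0.
  by move=> ki; have := a_ge0 k; have := a_single k; rewrite ki /=; lia.
(* A single pole, of order [b.+1]: the formula is exact if [b = e]; if [b < e], every [lead] is 0
   and [S] is negligible. *)
have [b ab] : exists b : nat, a i = b.+1%:Z.
  by exists (absz (a i)).-1; lia.
have SE : forall n, S n = q i ^+ n * pole_growth b n.
  apply: logder_single; apply: eq_logder HS => t; apply: eq_bigr => k _.
  by congr (_%:~R * _); have [->|/a0->] := eqVneq k i; rewrite ?mul1r ?mul0r.
have : (b <= e)%N by have := ae i; rewrite ab; lia.
rewrite leq_eqVlt => /predU1P[be|be].
  apply: eq_null (@null0 _) => n; rewrite SE be mulfK ?pole_growth_neq0 //.
  rewrite (bigD1 i) //= big1 ?addr0; last first.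
    by move=> k ki; rewrite /lead a0 // mul0r.
  rewrite /lead ab be eqxx big1 ?mul1r ?subrr // => l li.
  by rewrite a0 // oppr0 expr0z.
have bd n : `|q i ^+ n| <= 1 by rewrite normrX q_norm expr1n.
have := nullM_bounded (null_pole_growth_ratio be) bd; apply: eq_null => n.
rewrite SE mulrA big1 ?subr0 // => k _; rewrite /lead.
have [->|/a0->] := eqVneq k i; last by rewrite mul0r.
by rewrite ab ifF ?mul0r //; apply/negbTE; lia.
Qed.

Lemma null_main_term e a S : (forall i, a i <= e.+1%:Z) ->
  logder (psum q a) S ->
  null (fun n => (S n - n%:R ^+ e * (e`!%:R^-1 * \sum_k lead e a k * q k ^+ n))
                 / n%:R ^+ e).
Proof.
move=> ae HS; have H := pole_asymp_main ae HS.
have N1 := null_pole_growth_pow e.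
(* Writing [D] for the error in [H], [r] for that in [N1] and [o] for the oscillating sum,
   [S n / n ^ e] is [(1 + r) (D + o) / e!]; subtracting [o / e!] leaves [(r D + D + r o) / e!]. *)
have H1 := nullD (nullM N1 H) H.
have H2 := nullM_bounded N1 (osc_bounded (lead e a)).
have H3 := null_shift (nullZ e`!%:R^-1 (nullD H1 H2)).
apply: null_delayed; apply: eq_null H3 => n /=.
field.
by rewrite expf_neq0 ?pole_growth_neq0 ?nat1r ?pnatr_eq0 -?lt0n ?fact_gt0.
Qed.

End Poles.
End PoleAsymptotics.

(** * The moments of the characteristic polynomial *)

Lemma ltn_bin_left n m h : (m < h)%N -> (h.*2 <= n)%N ->
  ('C(n, m) < 'C(n, h))%N.
Proof.
elim: h => // h IHh mh hn.
have step : ('C(n, h) < 'C(n, h.+1))%N.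
  have C0 : (0 < 'C(n, h))%N by rewrite bin_gt0; lia.
  by rewrite -(ltn_pmul2l (ltn0Sn h)) mul_bin_left ltn_pmul2r //; lia.
move: mh; rewrite ltnS leq_eqVlt => /predU1P[->//|mh].
by apply: ltn_trans step; apply: IHh => //; lia.
Qed.

Lemma ltn_bin_outside n h j : (h.*2 <= n)%N -> (j <= n)%N ->
  ~~ (h <= j <= n - h)%N -> ('C(n, j) < 'C(n, h))%N.
Proof.
move=> hn jn; have [hj|jh _] := leqP h j; last exact: ltn_bin_left.
rewrite -ltnNge => nhj; rewrite -(bin_sub jn).
by apply: ltn_bin_left => //; lia.
Qed.

Lemma exprz_N1D2 (m n : int) : (-1 : int) ^ (m + n * 2) = (-1) ^ m.
Proof.
by rewrite exprzDr ?unitrN1 // (mulrC n) -exprz_exp exp1rz mulr1.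
Qed.

Section Moments.
Variable R : realType.
Local Notation C := R[i].

(** A positive complex number has zero imaginary part, so the Archimedean property of [R]
    applies. *)
Lemma complex_archi (e : C) : 0 < e -> exists N : nat, e < N%:R.
Proof.
case: e => a b; rewrite ltcE /= => /andP[/eqP b0 a0].
exists (Num.Def.archi_bound a); rewrite -(rmorph_nat (real_complex R)) ltcE /=.
by rewrite -b0 eqxx archi_boundP // ltW.
Qed.

Lemma null_cvg (u : nat -> C) (l : C) :
  null (fun n => u n - l) -> ((u : nat -> C^o) @ \oo --> (l : C^o))%classic.
Proof.
move=> nu; apply/(@cvgrPdist_lt _ C^o) => e /nu[N HN].
by near=> n; rewrite distrC; apply: HN; near: n; exact: nbhs_infty_ge.
Unshelve. all: by end_near.
Qed.

Variables (s1 s2 : nat) (x : C).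
Hypothesis x_norm : `|x| = 1.
Hypothesis x_nroot : forall m : nat, (0 < m)%N -> x ^+ m != 1.

Local Notation s := (s1 + s2)%N.

Lemma x_neq0 : x != 0.
Proof. by rewrite -normr_eq0 x_norm oner_eq0. Qed.

Lemma conj_x : x^* = x^-1.
Proof. by rewrite invC_norm x_norm expr1n invr1 mul1r. Qed.

Definition kidx (j : 'I_s.+1) : int := j%:Z - s2%:Z.
Definition pole (j : 'I_s.+1) : C := x ^ kidx j.
(** The pole order [(-1) ^ k] times the binomial coefficient, written as minus the exponent in [Cst]
    so that the factors of [Cst] and [lead] agree. *)
Definition mult (j : 'I_s.+1) : int :=
  - ((-1) ^ (kidx j + 1) * (binz s1 s2 (kidx j))%:Z).

Lemma pole_norm j : `|pole j| = 1.
Proof.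
by rewrite /pole; case: (kidx j) => n;
  rewrite ?NegzE -?exprnN ?normfV normrX x_norm expr1n ?invr1.
Qed.

(** A coincidence of two poles would make a positive power of [x] equal to 1. *)
Lemma pole_inj : injective pole.
Proof.
have lt_neq (i j : 'I_s.+1) : (i < j)%N -> pole i = pole j -> False.
  move=> ij eq_ij; have := x_nroot (_ : 0 < j - i)%N.
  rewrite subn_gt0 => /(_ ij)/eqP; apply.
  apply: (mulfI (_ : pole i != 0));
    first by rewrite -normr_eq0 pole_norm oner_eq0.
  rewrite mulr1 {2}eq_ij /pole exprnP -expfzDr ?x_neq0 //; congr (_ ^ _).
  by rewrite /kidx; lia.
move=> i j eq_ij; apply/val_inj; case: (ltngtP i j) => // /lt_neq; first exact.
by move=> /(_ (esym eq_ij)).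
Qed.

Lemma binz_kidx j : binz s1 s2 (kidx j) = 'C(s, j).
Proof. by rewrite /binz /kidx addrC subrK. Qed.

Lemma multE j : mult j = (-1) ^+ odd (j + s2) * 'C(s, j)%:Z.
Proof.
rewrite /mult binz_kidx -mulNr; congr (_ * _).
have -> : kidx j + 1 = (j + s2).+1%:Z + (- s2%:Z) * 2 by rewrite /kidx; lia.
by rewrite exprz_N1D2 -exprnP exprS mulN1r opprK signr_odd.
Qed.

(** With [y = x ^ m], the right side is [(-1) ^ s2 * y ^ (- s2) * (1 - y) ^ (s1 + s2)], expanded by
    the binomial theorem. *)
Lemma psum_pole m : psum pole mult m =
  (1 - x ^+ m) ^+ s1 * (1 - x^* ^+ m) ^+ s2.
Proof.
have y0 : x ^+ m != 0 by rewrite expf_neq0 ?x_neq0.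
rewrite conj_x exprVn; set y := x ^+ m in y0 *.
have -> : 1 - y^-1 = - (1 - y) / y by field.
rewrite expr_div_n exprNn mulrA mulrCA -exprD exprBn -mulrA mulr_suml mulr_sumr.
apply: eq_bigr => j _; rewrite multE signr_odd /pole.
have -> : (x ^ kidx j) ^+ m = y ^+ j / y ^+ s2.
  by rewrite [LHS]exprnP exprz_exp mulrC -exprz_exp /kidx expfzDr // exprnN.
by rewrite rmorphM rmorphXn rmorphN1 /= expr1n mulr1 -mulr_natr exprD; ring.
Qed.

(** Dividing [wsumS] by [n!] turns the falling factorial into [1 / (n - k)!], the normalisation of
    the smaller moment. *)
Lemma moment_logder : logder (psum pole mult) (moment s1 s2 x).
Proof.
have ZE n (y : C) (g : 'S_n) : Zn y g = wdet (fun=> y) g.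
  by congr (\det _); apply/matrixP => a b; rewrite !mxE.
have momentE n : moment s1 s2 x n = wsum s1 s2 x x^* n / n`!%:R.
  rewrite /moment /expect card_Sn; congr (_ / _).
  by apply: eq_bigr => g _; rewrite !ZE.
split=> [|n].
  rewrite momentE /wsum (eq_bigr (fun=> 1)).
    by rewrite sumr_const card_Sn fact0 divr1.
  by move=> g _; rewrite /wdet !det_mx00 !expr1n mulr1.
have f0 m : m`!%:R != 0 :> C by rewrite pnatr_eq0 -lt0n fact_gt0.
have -> : n.+1%:R * moment s1 s2 x n.+1 = n`!%:R^-1 * wsum s1 s2 x x^* n.+1.
  by rewrite momentE factS natrM; field; rewrite f0 nat1r pnatr_eq0.
rewrite wsumS mulr_sumr; apply: eq_bigr => k _; rewrite psum_pole momentE.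
have -> : (n ^_ k)%:R = n`!%:R / (n - k)`!%:R :> C.
  by rewrite -(ffact_fact (leq_ord k)) natrM mulfK.
by field; rewrite !f0.
Qed.

Lemma Cst_lead e j : mult j = e.+1%:Z ->
  Cst s1 s2 (kidx j) x = e`!%:R^-1 * lead pole e mult j.
Proof.
move=> mj; rewrite /Cst /lead mj eqxx binz_kidx.
have -> : ('C(s, j) - 1)%N = e.
  by move: mj; rewrite multE; case: (odd _); rewrite ?expr0 ?expr1; lia.
congr (_ * _); apply: eq_big => [l|l _].
  by rewrite (inj_eq (addIr _)) eqz_nat.
by rewrite /mult opprK conj_x /pole -/(kidx l) exprz_inv invr_expz.
Qed.

Lemma moment_main_term e : (forall j, mult j <= e.+1%:Z) ->
  null (fun n => (moment s1 s2 x n - n%:R ^+ e *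
    \sum_(j | mult j == e.+1%:Z) Cst s1 s2 (kidx j) x * pole j ^+ n)
    / n%:R ^+ e).
Proof.
move=> me.
have := null_main_term complex_archi pole_norm pole_inj me moment_logder.
apply: eq_null => n; congr ((_ - _ * _) / _).
rewrite mulr_sumr [RHS]big_mkcond; apply: eq_bigr => j _.
rewrite mulrA; case: eqP => [/Cst_lead->//|nmj].
by rewrite /lead; case: eqP nmj => // _ _; rewrite mulr0 mul0r.
Qed.

Lemma Cst_neq0 e j : mult j = e.+1%:Z -> Cst s1 s2 (kidx j) x != 0.
Proof.
move=> mj; rewrite (Cst_lead mj) /lead mj eqxx.
rewrite mulf_neq0 ?invr_eq0 ?pnatr_eq0 -?lt0n ?fact_gt0 //.
apply/prodf_neq0 => l lj; apply: expfz_neq0; rewrite subr_eq0 eq_sym.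
apply: contraNneq lj => h; apply/eqP/pole_inj.
have p0 : pole j != 0 by rewrite -normr_eq0 pole_norm oner_eq0.
by rewrite -(divfK p0 (pole l)) h mul1r.
Qed.

(** * Locating the poles of maximal order in each residue class modulo 4 *)

Lemma mult_even (j : 'I_s.+1) : ~~ odd (j + s2) -> mult j = 'C(s, j)%:Z.
Proof. by move=> /negbTE o; rewrite multE o mul1r. Qed.

Lemma mult_odd (j : 'I_s.+1) : odd (j + s2) -> mult j = - 'C(s, j)%:Z.
Proof. by move=> o; rewrite multE o expr1 mulN1r. Qed.

Lemma moment_single : ((s1%:Z - s2%:Z) %% 4)%Z != 2 ->
  let k0 := k0_of (s1%:Z - s2%:Z) in
  asymp_equiv (moment s1 s2 x)
    (fun n => n%:R ^+ ('C(s, s./2) - 1) * Cst s1 s2 k0 x * (x ^ k0) ^+ n).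
Proof.
move=> d4 k0.
(* For even [s] the unique central index has even [k]; for odd [s] exactly one of the two central
   indices does. *)
have [j0 [k0E j0_even j0_mid]] : exists j0 : 'I_s.+1,
    [/\ k0 = kidx j0, ~~ odd (j0 + s2)
      & j0 = s./2 :> nat \/ j0 = (s - s./2)%N :> nat].
  have k0s : (absz (k0 + s2%:Z)%R < s.+1)%N.
    by rewrite /k0 /k0_of; (case: ifP; last case: ifP); lia.
  exists (Ordinal k0s); rewrite /kidx /= /k0 /k0_of in k0s *.
  by split; move: k0s; (case: ifP; last case: ifP); lia.
have [e eE] : exists e, 'C(s, s./2) = e.+1.
  by exists ('C(s, s./2)).-1; rewrite prednK // bin_gt0; lia.
have half : (s./2.*2 <= s)%N by lia.
have binj0 : 'C(s, j0) = e.+1.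
  by rewrite -eE; case: j0_mid => ->; rewrite ?bin_sub //; lia.
have mj0 : mult j0 = e.+1%:Z by rewrite mult_even // binj0.
have le_bin (j : 'I_s.+1) : ('C(s, j) <= e.+1)%N /\
    ('C(s, j) = e.+1 -> ~~ odd (j + s2) -> j = j0).
  have js : (j <= s)%N by rewrite -ltnS.
  have [/andP[h1 h2]|/(ltn_bin_outside half js)] :=
    boolP (s./2 <= j <= s - s./2)%N.
    have [jE|jE] : j = s./2 :> nat \/ j = (s - s./2)%N :> nat by lia.
      by rewrite jE eE; split=> // _ o; apply/val_inj => /=; lia.
    by rewrite jE bin_sub ?eE; [split=> // _ o; apply/val_inj => /=; lia|lia].
  by rewrite eE => h; split; lia.
have me j : mult j <= e.+1%:Z.
  have [+ _] := le_bin j.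
  by case: (boolP (odd (j + s2))) => [/mult_odd|/mult_even] ->; lia.
have m_uniq j : (mult j == e.+1%:Z) = (j == j0).
  apply/eqP/eqP => [|->//]; have [_] := le_bin j.
  case: (boolP (odd (j + s2))) => [/mult_odd|o]; first by move=> -> _; lia.
  by rewrite (mult_even o) => H [/H]; apply.
apply: null_cvg; apply: null_delayed.
(* The main term divided by [n ^ e] has constant nonzero modulus, so the relative error is a bounded
   multiple of the error in [moment_main_term]. *)
pose B n := Cst s1 s2 k0 x * pole j0 ^+ n.
have c0 : Cst s1 s2 k0 x != 0 by rewrite k0E (Cst_neq0 mj0).
have p0 : pole j0 != 0 by rewrite -normr_eq0 pole_norm oner_eq0.
have bd n : `|(B n.+1)^-1| <= `|Cst s1 s2 k0 x|^-1.
  by rewrite normfV normrM normrX pole_norm expr1n mulr1.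
have := nullM_bounded (null_shift (moment_main_term me)) bd.
apply: eq_null => n; rewrite eE subn1 /= (big_pred1 j0) // -k0E.
rewrite /B.
have -> : x ^ k0 = pole j0 by rewrite k0E.
by field; rewrite c0 !expf_neq0 ?nat1r ?pnatr_eq0 // exprS mulf_neq0 ?expf_neq0.
Qed.

Lemma moment_double : ((s1%:Z - s2%:Z) %% 4)%Z = 2 ->
  let k0 : int := ((s1%:Z - s2%:Z) %/ 2)%Z in
  let w n : C := n%:R ^+ (binz s1 s2 (k0 - 1) - 1) in
  asymp_equiv_rel w (moment s1 s2 x)
    (fun n => w n * (Cst s1 s2 (k0 - 1) x * (x ^ (k0 - 1)) ^+ n
                     + Cst s1 s2 (k0 + 1) x * (x ^ (k0 + 1)) ^+ n)).
Proof.
(* Here [s] is even and at least 2. The central index [s./2] has odd [k] and gives a zero; its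
   neighbours [h] and [h.+2] share the largest binomial coefficient among even [k]. *)
move=> d4 k0 w; pose h := (s./2 - 1)%N.
have h_lt : (h < s.+1)%N by lia.
have h2_lt : (h.+2 < s.+1)%N by lia.
pose j1 := Ordinal h_lt; pose j2 := Ordinal h2_lt.
have k1 : k0 - 1 = kidx j1 by rewrite /kidx /k0 /=; lia.
have k2 : k0 + 1 = kidx j2 by rewrite /kidx /k0 /=; lia.
have [e eE] : exists e, 'C(s, h) = e.+1.
  by exists ('C(s, h)).-1; rewrite prednK // bin_gt0; lia.
have wE n : w n = n%:R ^+ e by rewrite /w k1 binz_kidx /= eE subn1.
have binh2 : 'C(s, h.+2) = e.+1.
  by rewrite (_ : h.+2 = (s - h)%N) ?bin_sub //; lia.
have ms j : mult j <= e.+1%:Z /\ (mult j == e.+1%:Z) = (j == j1) || (j == j2).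
  have js : (j <= s)%N by rewrite -ltnS.
  have hs : (h.*2 <= s)%N by lia.
  rewrite -[j == j1](inj_eq val_inj) -[j == j2](inj_eq val_inj) /=.
  case: (boolP (odd (j + s2))) => o; first by rewrite (mult_odd o); split; lia.
  rewrite (mult_even o).
  have [/andP[h1 h2]|] := boolP (h <= j <= s - h)%N.
    (* Between [h] and [s - h = h.+2] only [h.+1] is left, and parity excludes it. *)
    have [->|->] : nat_of_ord j = h \/ nat_of_ord j = h.+2 by lia.
      by rewrite eE !eqxx lexx.
    by rewrite binh2 !eqxx orbT lexx.
  by move=> out; have := ltn_bin_outside hs js out; rewrite eE; split; lia.
have me j : mult j <= e.+1%:Z by case: (ms j).
apply: null_cvg; have := moment_main_term me.
apply: eq_null => n; rewrite subr0 wE; congr ((_ - _ * _) / _).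
rewrite (eq_bigl _ _ (fun j => (ms j).2)) (bigD1 j1) ?eqxx //=.
rewrite (big_pred1 j2) -?k1 -?k2 /pole -?k1 -?k2 // => j.
rewrite /= andb_orl andbN /=; case: eqP => [->|]; last by [].
by rewrite andTb -(inj_eq val_inj) /=; lia.
Qed.

End Moments.

(** Reversing the product maps [k] to [- k], which preserves signs and binomial coefficients, while
    conjugation inverts [x]. The range of [k0] keeps the argument of [absz] nonnegative. *)
Lemma Cst_conj (R : realType) (s1 s2 : nat) (x : R[i]) (k0 : int) :
  `|x| = 1 -> - s1%:Z <= k0 <= s2%:Z ->
  Cst s1 s2 (- k0) x = (Cst s2 s1 k0 x)^*.
Proof.
move=> x_norm k0_range; have cx := conj_x x_norm.
have binE (k : int) : - s1%:Z <= k <= s2%:Z -> binz s1 s2 (- k) = binz s2 s1 k.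
  move=> k_range; rewrite /binz addnC -bin_sub; last by lia.
  by congr 'C(_, _); lia.
rewrite /Cst rmorphM fmorphV rmorph_nat binE //; congr (_ * _).
rewrite rmorph_prod /= (addnC s2 s1) (reindex_inj rev_ord_inj) /=.
have revE (j : 'I_(s1 + s2).+1) : ((s1 + s2).+1 - j.+1)%N%:Z - s2%:Z =
  - (j%:Z - s1%:Z).
  by have := leq_ord j; lia.
apply: eq_big => [j|j _]; rewrite revE; first by rewrite (inj_eq oppr_inj).
rewrite fmorphXz rmorphB rmorph1 rmorphM /= !fmorphXz /= conjCK !cx.
have jr : - s1%:Z <= j%:Z - s1%:Z <= s2%:Z by have := leq_ord j; lia.
have xV (l : int) : x^-1 ^ l = x ^ (- l) by exact: exprz_inv.
rewrite (binE _ jr) !xV opprK; congr (_ ^ (_ * _)).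
set k := j%:Z - s1%:Z.
have -> : k + 1 = - k + 1 + k * 2 by lia.
by rewrite exprz_N1D2.
Qed.

Theorem theorem4p5 (R : realType) (s1 s2 : nat) (x : R[i])
    (hx : `|x| = 1) (hroot : forall m : nat, (0 < m)%N -> x ^+ m != 1) :
  [/\ ((s1%:Z - s2%:Z) %% 4)%Z != 2 ->
      let k0 := k0_of (s1%:Z - s2%:Z) in
      asymp_equiv (moment s1 s2 x)
        (fun n => n%:R ^+ ('C(s1 + s2, (s1 + s2)./2) - 1)
                  * Cst s1 s2 k0 x * (x ^ k0) ^+ n),
      ((s1%:Z - s2%:Z) %% 4)%Z = 2 ->
      let k0 : int := ((s1%:Z - s2%:Z) %/ 2)%Z in
      let w n : R[i] := n%:R ^+ (binz s1 s2 (k0 - 1) - 1) in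
      asymp_equiv_rel w (moment s1 s2 x)
        (fun n => w n * (Cst s1 s2 (k0 - 1) x * (x ^ (k0 - 1)) ^+ n
                         + Cst s1 s2 (k0 + 1) x * (x ^ (k0 + 1)) ^+ n))
    & forall k0 : int, (2 %| k0)%Z -> - s1%:Z <= k0 <= s2%:Z ->
      Cst s1 s2 (- k0) x = (Cst s2 s1 k0 x)^*].
Proof.
split; [exact: moment_single|exact: moment_double|].
by move=> k0 _; apply: Cst_conj.
Qed.
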